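(* Let $\mathbb{F}$ be a field and let $R(s)\in\mathbb{F}(s)^{m\times n}$ be a rational matrix (respectively, let $R(s)\in\mathbb{F}[s]^{m\times n}$ be a polynomial matrix) with $\operatorname{rank}(R(s))=r$. Let $\mathbf{c}=(c_1,\dots,c_{n-r})$ be its column minimal indices. Let $z,x$ be integers such that $0\le x\le\min\{z,n-r\}$ and let $\mathbf{d}=(d_1,\dots,d_{n-r-x})$ be a partition. Let $h_x=\min\{i:d_{i-x+1}<c_i\}$. There exists a rational matrix $\widetilde W(s)\in\mathbb{F}(s)^{z\times n}$ (respectively, a polynomial matrix $\widetilde W(s)\in\mathbb{F}[s]^{z\times n}$) such that $\operatorname{rank}\begin{bmatrix}R(s)\\\widetilde W(s)\end{bmatrix}=r+x$ and $\begin{bmatrix}R(s)\\\widetilde W(s)\end{bmatrix}$ has $\mathbf{d}$ as column minimal indices if and only if $$d_i=c_{i+x},\quad h_x-x+1\le i\le n-r-x.$$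
   Context: Structural data. $\mathbb{F}(s)$ is the field of rational functions over $\mathbb{F}$. The rank of a matrix is its rank over $\mathbb{F}(s)$. For a subspace of $\mathbb{F}(s)^{k\times 1}$, a minimal basis is a basis of polynomial vectors whose sum of degrees is least among all polynomial bases; the degrees of its vectors (independent of the choice) are the minimal indices of the subspace. The column minimal indices of $R(s)\in\mathbb{F}(s)^{m\times n}$ are the minimal indices of $\{y\in\mathbb{F}(s)^{n\times1}:R y=0\}$, always listed in decreasing order; there are $n-r$ of them if $R$ has rank $r$. Conventions. ''Decreasing'' is meant in the weak sense. A partition is a decreasing sequence of nonnegative integers (possibly empty). A decreasing sequence $a_1\ge\dots\ge a_k$ is extended by $a_i=+\infty$ for $i<1$ and $a_i=-\infty$ for $i>k$. (So if $x=0$ then $h_0=0$.) A condition over an empty index range is trivially satisfied. *)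

(* Defs.v *)
From HB Require Import structures.
From mathcomp Require Import all_boot all_order all_algebra.
From mathcomp Require Import constructive_ereal.
From mathcomp Require Import zify.

Set Implicit Arguments.
Unset Strict Implicit.
Unset Printing Implicit Defensive.

Import Order.TTheory GRing.Theory Num.Theory.
Local Open Scope ring_scope.

Notation ratfun F := {fraction {poly F}}.

Notation ratmx M := (map_mx (@tofrac _) M).

Definition vdeg (F : fieldType) (k : nat) (v : 'cV[{poly F}]_k) : nat :=
  \max_(i < k) (size (v i 0%R)).-1.

Definition polynomial_basis (F : fieldType) (k : nat)
    (V : {vspace 'cV[ratfun F]_k}) (b : seq 'cV[{poly F}]_k) : bool :=
  basis_of V [seq ratmx v | v <- b].

Definition minimal_basis (F : fieldType) (k : nat)
    (V : {vspace 'cV[ratfun F]_k}) (b : seq 'cV[{poly F}]_k) : Prop :=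
  polynomial_basis V b /\
  forall b', polynomial_basis V b' ->
    (\sum_(v <- b) vdeg v <= \sum_(v <- b') vdeg v)%N.

Definition partition_seq (a : seq nat) : bool := sorted geq a.

(* The degrees of a minimal basis do not depend on the choice of the basis, so
   asking for one minimal basis is the same as asking for all of them. *)
Definition minimal_indices (F : fieldType) (k : nat)
    (V : {vspace 'cV[ratfun F]_k}) (a : seq nat) : Prop :=
  partition_seq a /\
  exists2 b, minimal_basis V b & perm_eq a [seq vdeg v | v <- b].

Definition rker (F : fieldType) (m n : nat) (R : 'M[ratfun F]_(m, n)) :
  {vspace 'cV[ratfun F]_n} := lker (linfun (mulmx R)).

Definition column_minimal_indices (F : fieldType) (m n : nat)
  (R : 'M[ratfun F]_(m, n)) (a : seq nat) : Prop := minimal_indices (rker R) a.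

(* Terms are numbered from 1: a_i = +oo for i < 1, a_i = -oo for i > size a. *)
Definition ext (a : seq nat) (i : int) : \bar int :=
  if i < 1 then +oo%E else nth -oo%E [seq (a_j%:Z)%:E | a_j <- a] `|i|.-1.

(* [is_h c d x h] says that h = min {i : d_(i-x+1) < c_i}, i ranging over all
   integers. *)
Definition is_h (c d : seq nat) (x : nat) (h : int) : Prop :=
  (ext d (h - x%:Z + 1) < ext c h)%E /\
  forall i : int, (ext d (i - x%:Z + 1) < ext c i)%E -> h <= i.

Lemma rkerP (F : fieldType) (m n : nat) (R : 'M[ratfun F]_(m, n))
    (y : 'cV[ratfun F]_n) : (y \in rker R) = (R *m y == 0).
Proof. by rewrite memv_ker lfunE. Qed.

Lemma is_h_ex (c d : seq nat) (x : nat) :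
  (size d + x = size c)%N -> exists h, is_h c d x h.
Proof.
move=> sz; pose P (k : nat) := (ext d (k%:Z - x%:Z + 1) < ext c k%:Z)%E.
have exP : exists k, P k.
  exists (size c); rewrite /P; have -> : (size c)%:Z - x%:Z + 1 = (size d).+1%:Z.
    by lia.
  rewrite [ext d _]/ext /= nth_default ?size_map //.
  rewrite /ext; case: ifP => // /negbT c1.
  by rewrite (nth_map 0%N) ?ltNyr //; lia.
exists (ex_minn exP)%:Z; case: ex_minnP => k Pk kmin; split=> // i Pi.
case: i Pi => [i|i] Pi; first by rewrite lez_nat; apply: kmin.
move: Pi; rewrite /ext.
by have -> : Negz i - x%:Z + 1 < 1 by lia.
Qed.

Lemma is_h_uniq (c d : seq nat) (x : nat) (h h' : int) :
  is_h c d x h -> is_h c d x h' -> h = h'.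
Proof.
by move=> [Ph hmin] [Ph' hmin']; apply/eqP; rewrite eq_le hmin // hmin'.
Qed.

(* Main.v *)
Require Import Defs.
From HB Require Import structures.
From mathcomp Require Import all_boot all_order all_algebra.
From mathcomp Require Import constructive_ereal.
From mathcomp Require Import generic_quotient zify.

Set Implicit Arguments.
Unset Strict Implicit.
Unset Printing Implicit Defensive.

Import Order.TTheory GRing.Theory Num.Theory.
Local Open Scope ring_scope.

(** The kernels of the matrices obtained from R by appending z rows are the
    subspaces U of V = ker R with dim V - dim U <= z.  Multiplying the appended
    rows by a common denominator keeps the kernel, so that the rational and
    the polynomial cases agree, and the theorem becomes a statement on pairs
    U <= V: which partitions d are the minimal indices of a subspace U of
    codimension x, when V has minimal indices c?

    A minimal basis (b_i) of V has two strong properties, jointly called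
    [predictable_degrees] below: a polynomial vector v of V has polynomial
    coordinates p_i, and deg p_i + deg b_i <= deg v whenever p_i <> 0.  Both
    come from one exchange argument [minimal_support]: if the coordinate of v
    at b_i is nonzero, replacing b_i by v gives another polynomial basis, so
    deg b_i <= deg v; a failure of either property would produce a vector that
    contradicts this [minimal_integral, minimal_predictable].  Conversely these
    properties imply minimality [predictable_minimal].  In particular, the
    number of minimal indices of V at most e is the dimension of the span of
    the polynomial vectors of V of degree at most e.

    Necessity [subspace_low_indices].  Such a span contains, for V, the one for U.
    By the definition of h, the indices d_i with i > h - x are less than c_h,
    and there are as many of them as there are c_i with i > h; hence
    the two spans agree at that degree, then at all lower degrees, and so do
    the minimal indices.

    Sufficiency [subspace_with_indices].  By the minimality of h one has
    d_j >= c_(j+x-1) for 1 <= j <= h - x.  Take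
      u_j = s^(d_j - c_(j+x-1)) b_(j+x-1) + b_(j+x)   for 1 <= j <= h - x,
      u_j = b_(j+x)                                   for j > h - x.
    The matrix of coordinates is bidiagonal.  Its entries 1 give polynomial
    coordinates on u from polynomial coordinates on b, by descending
    substitution; its other entries give the degree bound, by ascending
    substitution.  So u is the minimal basis of its span, with degrees d.

    Below, sequences are numbered from 0 and t stands for h - x; thus the
    c_(j+x-1) above becomes the entry (j + x).-1 of c, for j < t. *)

(** * Fractions, polynomials and sorted sequences *)

Lemma frac_num_den (D : idomainType) (x : {fraction D}) :
  exists p q : D, q != 0 /\ x * tofrac q = tofrac p.
Proof.
elim/quotW: x => y; exists (\n_y), (\d_y); split; first exact: denom_ratioP.
unlock tofrac; rewrite -[LHS]FracField.pi_mul; apply/eqmodP.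
rewrite /= FracField.equivfE /FracField.mulf.
by rewrite !numden_Ratio ?mulr1 ?oner_neq0 ?denom_ratioP // mulrC.
Qed.

Lemma common_denominator (D : idomainType) (I : finType)
    (a : I -> {fraction D}) :
  exists (g : D) (p : I -> D), g != 0 /\ forall i, a i * tofrac g = tofrac (p i).
Proof.
have /fin_all_exists[p0 /fin_all_exists[q pqP]] := fun i => frac_num_den (a i).
exists (\prod_i q i), (fun i => p0 i * \prod_(j | j != i) q j); split.
  by apply/prodf_neq0 => i _; case: (pqP i).
by move=> i; rewrite (bigD1 i) //= !tofracM mulrA (pqP i).2.
Qed.

(** The top coefficient of a product, when the sizes are only bounded. *)
Lemma coefM_top (A : nzSemiRingType) (p q : {poly A}) (m n : nat) :
  (size p <= m.+1)%N -> (size q <= n.+1)%N -> (p * q)`_(m + n) = p`_m * q`_n.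
Proof.
move=> sp sq; have lt_m : (m < (m + n).+1)%N by lia.
rewrite coefM (bigD1 (Ordinal lt_m)) //= addKn big1 ?addr0 // => i.
rewrite -val_eqE /= => ne_im; case: (ltnP m i) => [lt_mi|le_im].
  by rewrite (nth_default _ (leq_trans sp lt_mi)) mul0r.
by rewrite [q`__](nth_default _ (leq_trans sq _)) ?mulr0 //; lia.
Qed.

Lemma codom_nth (T : Type) (x0 : T) (s : seq T) n :
  size s = n -> codom (fun i : 'I_n => nth x0 s i) = s.
Proof.
move=> <-; rewrite codomE -[RHS](mkseq_nth x0) /mkseq -val_enum_ord.
by rewrite -map_comp.
Qed.

Definition count_atmost (e : nat) (s : seq nat) := count (fun n => n <= e)%N s.

(** The sum of s is the sum over e of the number of entries greater than e. *)
Lemma leq_sumn_count (s t : seq nat) :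
  size s = size t -> (forall e, count_atmost e t <= count_atmost e s)%N ->
  (sumn s <= sumn t)%N.
Proof.
move=> eq_sz le_count; pose M := (sumn s + sumn t)%N.
have layers (u : seq nat) : (sumn u <= M)%N ->
    sumn u = (\sum_(e < M) (size u - count_atmost e u))%N.
  elim: u => [|n u IHu] /=; first by rewrite big1.
  move=> leM; rewrite IHu; last by lia.
  have nE : n = (\sum_(e < M) (e < n))%N.
    rewrite -[LHS]card_ord -sum1_card (big_ord_widen M (fun=> 1%N)); last by lia.
    by rewrite big_mkcond; apply: eq_bigr => e _; case: ifP.
  rewrite {1}nE -big_split /=; apply: eq_bigr => e _; rewrite ltnNge.
  have := count_size (fun m => m <= e)%N u.
  by rewrite /count_atmost /=; case: (n <= e)%N => /=; lia.
rewrite (layers s) ?leq_addr // (layers t) ?leq_addl //; apply: leq_sum => e _.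
by rewrite eq_sz leq_sub2l.
Qed.

Lemma geq_trans : transitive geq.
Proof. by move=> n m p le_nm le_pn; apply: leq_trans le_pn le_nm. Qed.

(** A decreasing sequence can be read off from its counting function. *)
Lemma sorted_geq_count (s : seq nat) (i e : nat) :
  sorted geq s -> (i < size s)%N ->
  (nth 0%N s i <= e)%N = (size s - i <= count_atmost e s)%N.
Proof.
elim: s i => [|n s IHs] // i n_s.
rewrite (_ : count_atmost e (n :: s) = (n <= e) + count_atmost e s)%N //.
have le_size : (count_atmost e s <= size s)%N := count_size _ s.
have full : (n <= e)%N -> count_atmost e s = size s.
  move=> le_ne; apply/eqP; rewrite -all_count.
  apply: sub_all (order_path_min geq_trans n_s) => m /= le_mn.
  exact: leq_trans le_mn le_ne.
case: i => [|i]; rewrite /= ?ltnS => lt_i.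
  by case: (n <= e)%N full => [/(_ isT)|_] /=; lia.
rewrite IHs ?(path_sorted n_s) //.
by case: (n <= e)%N full => [/(_ isT)|_] /=; lia.
Qed.

(** * Minimal bases and predictable degrees *)

Section PolynomialFamilies.

Variables (F : fieldType) (k : nat).
Implicit Types (v : 'cV[{poly F}]_k) (V : {vspace 'cV[ratfun F]_k}).

Lemma ratmx_inj m n : injective (fun M : 'M[{poly F}]_(m, n) => ratmx M).
Proof.
move=> A B /matrixP eAB; apply/matrixP=> i j.
by have /eqP := eAB i j; rewrite !mxE tofrac_eq => /eqP.
Qed.

(** The relation deg v < E; unlike a bound on [vdeg], the bound E = 0 is
    meaningful and forces v = 0. *)
Definition size_bound v (E : nat) := forall i, (size (v i 0%R) <= E)%N.

Lemma size_boundP v e : reflect (size_bound v e.+1) (vdeg v <= e)%N.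
Proof.
apply: (iffP (bigmax_leqP _ _ _)) => H i; first by have := H i isT; lia.
by move=> _; have := H i; lia.
Qed.

Lemma size_bound_vdeg v : size_bound v (vdeg v).+1.
Proof. exact/size_boundP. Qed.

Section Family.

Variable N : nat.
Implicit Types (b : 'I_N -> 'cV[{poly F}]_k) (a : 'I_N -> ratfun F).

Definition ratfam b : N.-tuple 'cV[ratfun F]_k := [tuple ratmx (b i) | i < N].

Definition ratcomb a b : 'cV[ratfun F]_k := \sum_i a i *: ratmx (b i).

Lemma polynomial_basis_codom V b :
  polynomial_basis V (codom b) = basis_of V (ratfam b).
Proof.
by rewrite /polynomial_basis /ratfam /= codomE -map_comp; congr basis_of.
Qed.

Lemma ratcombE a b : ratcomb a b = \sum_(i < N) a i *: (ratfam b)`_i.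
Proof. by apply: eq_bigr => i _; rewrite nth_mktuple. Qed.

Lemma span_ratcomb b y : y \in <<ratfam b>>%VS -> exists a, y = ratcomb a b.
Proof.
by move/coord_span=> ->; exists (fun i => coord (ratfam b) i y); rewrite ratcombE.
Qed.

Lemma ratfam_in b i : ratmx (b i) \in <<ratfam b>>%VS.
Proof. by apply/memv_span/mapP; exists i; rewrite // mem_enum. Qed.

Lemma ratcomb_span a b : ratcomb a b \in <<ratfam b>>%VS.
Proof. by apply: memv_suml => i _; rewrite memvZ ?ratfam_in. Qed.

Lemma ratmx_polycomb (p : 'I_N -> {poly F}) b :
  ratmx (\sum_i p i *: b i) = ratcomb (fun i => tofrac (p i)) b.
Proof. by rewrite map_mx_sum; apply: eq_bigr => i _; rewrite map_mxZ. Qed.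

Lemma exchange_basis V b v a j :
  basis_of V (ratfam b) -> ratmx v = ratcomb a b -> a j != 0 ->
  basis_of V (ratfam (fun i => if i == j then v else b i)).
Proof.
move=> bV va aj0; rewrite basisEdim size_tuple (size_basis bV) leqnn andbT.
set b' := fun i => _; rewrite -(span_basis bV); apply/span_subvP => _ /mapP[i _ ->].
have [-> | ne_ij] := eqVneq i j; last first.
  by have := ratfam_in b' i; rewrite /b' (negPf ne_ij).
have -> : ratmx (b j) = (a j)^-1 *: (ratmx v - \sum_(l | l != j) a l *: ratmx (b l)).
  by rewrite va /ratcomb (bigD1 j) //= addrK scalerA mulVf ?scale1r.
rewrite memvZ // memvB //; first by have := ratfam_in b' j; rewrite /b' eqxx.
apply: memv_suml => l ne_lj; rewrite memvZ //.
by have := ratfam_in b' l; rewrite /b' (negPf ne_lj).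
Qed.

(** Exchanging b_j for v gives another polynomial basis, whose sum of degrees is
    not smaller.  For E = 0 the claim is that a free family has no nontrivial
    relation. *)
Lemma minimal_support V b v a E j :
  minimal_basis V (codom b) -> size_bound v E -> ratmx v = ratcomb a b ->
  a j != 0 -> (vdeg (b j) < E)%N.
Proof.
case=> bV minb; rewrite polynomial_basis_codom in bV.
case: E => [|E] vE va aj0.
  have v0 : v = 0.
    by apply/matrixP=> i l; rewrite mxE ord1; apply/size_poly_leq0P/vE.
  move/basis_free/freeP: bV => /(_ a); rewrite -ratcombE -va v0 map_mx0.
  by move=> /(_ erefl j) aj; rewrite aj eqxx in aj0.
have := minb (codom (fun i => if i == j then v else b i)).
rewrite polynomial_basis_codom => /(_ (exchange_basis bV va aj0)).
rewrite /codom !big_image /= (bigD1 j) //= [X in (_ <= X)%N](bigD1 j) //= eqxx.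
rewrite [X in (_ <= _ + X)%N](eq_bigr (fun i => vdeg (b i))); last first.
  by move=> i /negPf ->.
by move/size_boundP: vE; lia.
Qed.

(** The factor 'X^(c i) shifts the size of p by c i, except when p = 0, where
    there is nothing to bound. *)
Definition predictable_degrees b (c : 'I_N -> nat) :=
  forall v a E, size_bound v E -> ratmx v = ratcomb a b ->
  forall i, exists p, a i = tofrac p /\ (size (p * 'X^(c i))%R <= E)%N.

(** Let g be a common denominator, p_l / g the coordinates of v, and r_l the
    remainder of p_l modulo g.  The vector w with coordinates r_l / g is
    polynomial, since it differs from v by a polynomial combination of b, and its
    degree is less than the largest deg b_j with r_j <> 0; so all r_l are 0. *)
Lemma minimal_integral V b v a :
  minimal_basis V (codom b) -> ratmx v = ratcomb a b ->
  exists p : 'I_N -> {poly F}, forall i, a i = tofrac (p i).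
Proof.
move=> minb va; have [g [p [g0 agp]]] : exists (g : {poly F}) (p : 'I_N -> {poly F}),
    g != 0 /\ forall i, a i * tofrac g = tofrac (p i) by exact: common_denominator.
pose r i : {poly F} := p i %% g.
exists (fun i => p i %/ g) => i.
have g0F : tofrac g != 0 by rewrite tofrac_eq0.
case: (pickP (fun j => r j != 0)) => [j0 rj0 | r0]; last first.
  apply: (mulIf g0F); rewrite agp -tofracM {1}(divp_eq (p i) g).
  by have /negbFE/eqP := r0 i; rewrite /r => ->; rewrite addr0.
have [j rj jmax] : exists2 j, r j != 0 &
    forall l, r l != 0 -> (vdeg (b l) <= vdeg (b j))%N.
  by case: (@arg_maxnP _ j0 (fun j => r j != 0) (fun j => vdeg (b j)) rj0) => j; exists j.
pose w := v - \sum_l (p l %/ g) *: b l.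
have wE : ratmx w = ratcomb (fun l => tofrac (r l) / tofrac g) b.
  rewrite map_mxB ratmx_polycomb va /ratcomb -sumrB; apply: eq_bigr => l _.
  rewrite -scalerBl; congr (_ *: _); apply: (mulIf g0F).
  rewrite mulrBl agp divfK // -tofracM -tofracB.
  by rewrite {1}(divp_eq (p l) g) addrAC subrr add0r.
have gw : g *: w = \sum_l r l *: b l.
  apply: ratmx_inj; rewrite map_mxZ wE ratmx_polycomb /ratcomb scaler_sumr.
  by apply: eq_bigr => l _; rewrite scalerA mulrC divfK.
have wj : size_bound w (vdeg (b j)).
  move=> l; have [->|wl0] := eqVneq (w l 0) 0; first by rewrite size_poly0.
  have : (size (g * w l 0)%R <= (size g).-1 + vdeg (b j))%N.
    have -> : g * w l 0 = \sum_i0 r i0 * b i0 l 0.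
      have /matrixP/(_ l 0) := gw; rewrite mxE summxE => ->.
      by apply: eq_bigr => i0 _; rewrite mxE.
    apply: leq_trans (size_sum _ _ _) _; apply/bigmax_leqP => i0 _.
    have [->|ri0] := eqVneq (r i0) 0; first by rewrite mul0r size_poly0.
    apply: leq_trans (size_polyMleq (r i0) (b i0 l 0)) _.
    have := size_bound_vdeg (b i0) l; have := jmax _ ri0.
    have : (size (r i0) < size g)%N by rewrite ltn_modp.
    by lia.
  have sg : (0 < size g)%N by rewrite size_poly_gt0.
  have cancel_size (s t u : nat) :
    (0 < s)%N -> ((s + t).-1 <= s.-1 + u)%N -> (t <= u)%N by lia.
  by rewrite size_mul //; apply: cancel_size.
suff : tofrac (r j) / tofrac g != 0.
  by move/(minimal_support minb wj wE); rewrite ltnn.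
by apply: mulf_neq0; [rewrite tofrac_eq0 | rewrite invr_eq0].
Qed.

(** Let c_l = deg b_l.  If deg v were less than M - 1 = max (deg p_l + c_l), the
    terms of degree M - 1 would cancel: the leading coefficients f_l of the p_l
    that reach the maximum would be the coefficients of a linear relation between
    the leading coefficient vectors of these b_l.  With c_j the largest of these
    degrees, the sum of the f_l 'X^(c_j - c_l) b_l would have degree less than c_j,
    against [minimal_support]. *)
Lemma minimal_predictable V b :
  minimal_basis V (codom b) -> predictable_degrees b (fun i => vdeg (b i)).
Proof.
move=> minb v a E vE va i.
have [p ap] := minimal_integral minb va; exists (p i); split=> //.
pose c i := vdeg (b i); pose s i := size (p i * 'X^(c i)).
rewrite -/(c i) -/(s i) leqNgt; apply/negP => lt_E.
pose M := \max_i s i.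
have leM l : (s l <= M)%N by apply: leq_bigmax.
have [|j0 Mj0] := @bigop.eq_bigmax _ s; first by apply/card_gt0P; exists i.
rewrite -/M in Mj0.
have ltEM : (E < M)%N by apply: leq_trans lt_E (leM i).
have sE l : p l != 0 -> s l = (c l + size (p l))%N.
  by move=> pl0; rewrite /s size_mulXn.
(* f l vanishes unless deg (p l) + c l reaches the maximum M - 1. *)
pose f l := (p l * 'X^(c l))`_M.-1.
have fj0 : f j0 != 0.
  have : p j0 * 'X^(c j0) != 0 by rewrite -size_poly_gt0 -/(s j0) -Mj0; lia.
  by rewrite -lead_coef_eq0 /lead_coef -/(s j0) -Mj0.
have [j fj jmax] : exists2 j, f j != 0 & forall l, f l != 0 -> (c l <= c j)%N.
  by case: (@arg_maxnP _ j0 (fun j => f j != 0) c fj0) => j; exists j.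
pose q l : {poly F} := (f l)%:P * 'X^(c j - c l).
have wj : size_bound (\sum_l q l *: b l) (c j).
  move=> t; rewrite summxE; under eq_bigr do rewrite mxE.
  have qb l : (size (q l * b l t 0)%R <= (c j).+1)%N /\
    (q l * b l t 0)`_(c j) = (p l * b l t 0)`_M.-1.
    have [pl0|pl0] := eqVneq (p l) 0.
      by rewrite /q /f pl0 !mul0r coef0 !mul0r size_poly0 coef0.
    have sbl := size_bound_vdeg (b l) t; rewrite -/(c l) in sbl.
    have lesl := leM l; rewrite sE // in lesl.
    have spl : (0 < size (p l))%N by rewrite size_poly_gt0.
    have fE : f l = (p l)`_(M.-1 - c l) by rewrite /f coefMXn ifN //; lia.
    have -> : (p l * b l t 0)`_M.-1 = f l * (b l t 0)`_(c l).
      by rewrite -{1}(@subnK (c l) M.-1) ?coefM_top ?fE //; lia.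
    have [fl0|fl0] := eqVneq (f l) 0.
      by rewrite /q fl0 !mul0r size_poly0 coef0.
    have lecj := jmax l fl0.
    have sq : (size (q l) <= (c j - c l).+1)%N.
      by rewrite /q mul_polyC (leq_trans (size_scale_leq _ _)) ?size_polyXn.
    split; last first.
      rewrite -{1}(subnK lecj) coefM_top //; congr (_ * _).
      by rewrite /q coefCM coefXn eqxx mulr1.
    by apply: leq_trans (size_polyMleq _ _) _; lia.
  apply/leq_sizeP => u; rewrite leq_eqVlt => /predU1P[<-|lt_u]; last first.
    rewrite coef_sum big1 // => l _; apply/nth_default/(leq_trans _ lt_u).
    exact: (qb l).1.
  rewrite coef_sum; under eq_bigr => l _ do rewrite (qb l).2.
  have -> : \sum_l (p l * b l t 0)`_M.-1 = (v t 0)`_M.-1.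
    have -> : v = \sum_l p l *: b l.
      apply: ratmx_inj; rewrite ratmx_polycomb va.
      by apply: eq_bigr => l _; rewrite ap.
    by rewrite summxE coef_sum; apply: eq_bigr => l _; rewrite mxE.
  apply: nth_default; apply: leq_trans (vE t) _; lia.
suff : tofrac (q j) != 0.
  by move/(minimal_support minb wj (ratmx_polycomb q b)); rewrite ltnn.
by rewrite tofrac_eq0 /q subnn mulr1 polyC_eq0.
Qed.

Lemma predictable_free b c : predictable_degrees b c -> free (ratfam b).
Proof.
move=> pred_b; apply/freeP => a; rewrite -ratcombE => a0 i.
have [||p [-> szp]] := @pred_b 0 a 0%N _ _ i.
- by move=> l; rewrite mxE size_poly0.
- by rewrite map_mx0 a0.
move: szp; rewrite leqn0 size_poly_eq0 mulf_eq0.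
by rewrite (negPf (monic_neq0 (monicXn _ _))) orbF => /eqP->; rewrite tofrac0.
Qed.

Definition low_span b (c : 'I_N -> nat) (e : nat) :=
  <<[seq ratmx (b i) | i <- enum 'I_N & (c i <= e)%N]>>%VS.

Lemma low_span_dim b c e :
  free (ratfam b) -> \dim (low_span b c e) = count_atmost e (codom c).
Proof.
move=> free_b; have -> : count_atmost e (codom c) =
    size [seq ratmx (b i) | i <- enum 'I_N & (c i <= e)%N].
  by rewrite size_map size_filter /count_atmost codomE count_map.
pose low i := (c i <= e)%N.
apply/eqnP; apply: (@catl_free _ _ [seq ratmx (b i) | i <- enum 'I_N & predC low i]).
by rewrite -map_cat (perm_free (perm_map _ (permEl (perm_filterC low _)))).
Qed.

Lemma low_span_in b c e i : (c i <= e)%N -> ratmx (b i) \in low_span b c e.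
Proof. by move=> ce; apply/memv_span/map_f; rewrite mem_filter ce mem_enum. Qed.

Lemma predictable_low_span b c v e :
  predictable_degrees b c -> ratmx v \in <<ratfam b>>%VS -> (vdeg v <= e)%N ->
  ratmx v \in low_span b c e.
Proof.
move=> pred_b /span_ratcomb[a va] /size_boundP le_v; rewrite va.
apply: memv_suml => i _; have [p [-> szp]] := pred_b _ _ _ le_v va i.
have [->|p0] := eqVneq p 0; first by rewrite tofrac0 scale0r mem0v.
apply/memvZ/low_span_in; move: p0 szp; rewrite -size_poly_gt0 => p0.
by rewrite size_mulXn -?size_poly_gt0 //; lia.
Qed.

End Family.

Lemma low_span_sub N N' (b : 'I_N -> 'cV[{poly F}]_k) (c : 'I_N -> nat)
    (u : 'I_N' -> 'cV[{poly F}]_k) e :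
  predictable_degrees b c -> (<<ratfam u>> <= <<ratfam b>>)%VS ->
  (low_span u (fun i => vdeg (u i)) e <= low_span b c e)%VS.
Proof.
move=> pred_b /subvP sub; apply/span_subvP => _ /mapP[i low_i ->].
move: low_i; rewrite mem_filter => /andP[le_e _].
by apply: predictable_low_span; rewrite ?sub ?ratfam_in.
Qed.

(** By [low_span_sub], no polynomial basis of the same space has more vectors
    of degree at most e than b, for any e; hence none has a smaller sum. *)
Lemma predictable_minimal N (b : 'I_N -> 'cV[{poly F}]_k) (c : 'I_N -> nat) :
  predictable_degrees b c -> (forall i, (vdeg (b i) <= c i)%N) ->
  minimal_basis <<ratfam b>>%VS (codom b) /\ forall i, vdeg (b i) = c i.
Proof.
move=> pred_b le_c; have free_b := predictable_free pred_b.
have deg_c i : vdeg (b i) = c i.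
  apply/eqP; rewrite eqn_leq le_c /=.
  have bi : ratmx (b i) = ratcomb (fun j => tofrac (i == j)%:R) b.
    rewrite -ratmx_polycomb (bigD1 i) //= eqxx scale1r big1 ?addr0 // => j.
    by rewrite eq_sym => /negPf->; rewrite scale0r.
  have [p [/eqP]] := pred_b _ _ _ (size_bound_vdeg (b i)) bi i.
  by rewrite tofrac_eq eqxx => /eqP <-; rewrite mul1r size_polyXn.
split=> //; split; first by rewrite polynomial_basis_codom /basis_of eqxx.
move=> b' basis_b'.
pose u (i : 'I_(size b')) := b'`_i.
have b'E : b' = codom u by rewrite (codom_nth 0).
move: basis_b'; rewrite b'E polynomial_basis_codom => basis_u.
have deg_sum M (f : 'I_M -> 'cV[{poly F}]_k) :
    \sum_(v <- codom f) vdeg v = sumn (codom (fun i => vdeg (f i))).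
  by rewrite sumnE /codom !big_image.
rewrite !deg_sum; apply: leq_sumn_count.
  by rewrite !size_codom !card_ord -(size_basis basis_u) (eqnP free_b) size_tuple.
move=> e; rewrite -(low_span_dim _ _ (basis_free basis_u)) -(low_span_dim _ _ free_b).
apply/dimvS/low_span_sub; last by rewrite (span_basis basis_u).
move=> v a E vE va i; have [p [-> szp]] := pred_b v a E vE va i.
by exists p; rewrite deg_c.
Qed.

(** If U and V have the same number of minimal indices at most e0, the vectors
    of degree at most e0 span the same space in both; then every vector of V of
    degree e <= e0 is in U. *)
Lemma minimal_count_eq N N' (b : 'I_N -> 'cV[{poly F}]_k)
    (u : 'I_N' -> 'cV[{poly F}]_k) e0 e
    (cb := codom (fun i => vdeg (b i))) (cu := codom (fun i => vdeg (u i))) :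
  minimal_basis <<ratfam b>>%VS (codom b) ->
  minimal_basis <<ratfam u>>%VS (codom u) ->
  (<<ratfam u>> <= <<ratfam b>>)%VS ->
  (count_atmost e0 cb <= count_atmost e0 cu)%N -> (e <= e0)%N ->
  count_atmost e cb = count_atmost e cu.
Proof.
move=> /minimal_predictable pb /minimal_predictable pu sub le0 le_e.
have fb := predictable_free pb; have fu := predictable_free pu.
have eq0 : low_span u (fun i => vdeg (u i)) e0 = low_span b (fun i => vdeg (b i)) e0.
  by apply/eqP; rewrite eqEdim low_span_sub //= !low_span_dim.
rewrite -(low_span_dim _ _ fb) -(low_span_dim _ _ fu); congr (\dim _).
apply/eqP; rewrite eqEsubv; apply/andP; split; last exact: low_span_sub.
apply/span_subvP => _ /mapP[i low_i ->].
move: low_i; rewrite mem_filter => /andP[le_i _].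
apply: predictable_low_span => //.
have : ratmx (b i) \in low_span b (fun i => vdeg (b i)) e0.
  by apply: low_span_in; apply: leq_trans le_i le_e.
rewrite -eq0; apply/subvP/span_subvP => _ /mapP[j _ ->]; exact: ratfam_in.
Qed.

(** * A subspace with prescribed minimal indices *)

Lemma leq_size_mulXn (p : {poly F}) (c e E : nat) :
  (c <= e)%N -> (size (p * 'X^e)%R <= E)%N -> (size (p * 'X^c)%R <= E)%N.
Proof.
have [->|p0] := eqVneq p 0; first by rewrite !mul0r.
by rewrite !size_mulXn // => le_ce; apply: leq_trans; rewrite leq_add2r.
Qed.

Section Staircase.

Variables (m x t : nat) (b : nat -> 'cV[{poly F}]_k) (c d : nat -> nat).
Hypothesis le_tm : (t <= m)%N.
Hypothesis x_gt0 : (0 < t)%N -> (0 < x)%N.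
Hypothesis c_anti : forall i j, (i <= j < m + x)%N -> (c j <= c i)%N.
Hypothesis le_cd : forall j, (j < t)%N -> (c (j + x).-1 <= d j)%N.
Hypothesis eq_cd : forall j, (t <= j < m)%N -> d j = c (j + x).

Definition stair j : {poly F} :=
  if (j < t)%N then 'X^(d j - c (j + x).-1) else 0.

Definition staircase j := stair j *: b (j + x).-1 + b (j + x)%N.

(** The coordinate of [staircase j] at b_i. *)
Definition stair_coef i j : {poly F} :=
  (i == j + x)%N%:R + (i == (j + x).-1)%N%:R * stair j.

Lemma ratcomb_staircase (q : 'I_m -> ratfun F) :
  ratcomb q (fun j => staircase j) =
  ratcomb (fun i : 'I_(m + x) => \sum_(j < m) tofrac (stair_coef i j) * q j)
          (fun i => b i).
Proof.
rewrite /ratcomb; under [RHS]eq_bigr do rewrite scaler_suml.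
rewrite exchange_big; apply: eq_bigr => j _.
have pick (n : nat) (a : ratfun F) : (n < m + x)%N ->
    \sum_(i < m + x) ((i == n :> nat)%:R * a) *: ratmx (b i) = a *: ratmx (b n).
  move=> lt_n; rewrite (bigD1 (Ordinal lt_n)) //= eqxx mul1r big1 ?addr0 // => i.
  by rewrite -val_eqE /= => /negPf->; rewrite mul0r scale0r.
have jm := ltn_ord j.
under eq_bigr do
  rewrite tofracD tofracM !rmorph_nat mulrDl scalerDl -mulrA.
rewrite big_split /= !pick; [|lia..].
by rewrite map_mxD map_mxZ scalerDr scalerA mulrC addrC.
Qed.

Lemma stair_coef_diag j : stair_coef (j + x)%N j = 1.
Proof.
rewrite /stair_coef eqxx; case: eqP => [jx|_]; last by rewrite mul0r addr0.
by rewrite /stair ifN ?mulr0 ?addr0 //; move: x_gt0; lia.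
Qed.

Lemma stair_coef_lt j l : (l < j)%N -> stair_coef (j + x)%N l = 0.
Proof.
move=> lt_lj; rewrite /stair_coef.
have -> : (j + x == l + x)%N = false by lia.
have -> : (j + x == (l + x).-1)%N = false by lia.
by rewrite mul0r addr0.
Qed.

Lemma stair_coef_flat j l : (t <= j)%N -> l != j -> stair_coef (j + x)%N l = 0.
Proof.
move=> le_tj ne_lj; have [/stair_coef_lt //|le_jl] := ltnP l j.
rewrite /stair_coef /stair ifN ?mulr0 ?addr0; last by lia.
by rewrite eqn_add2r eq_sym (negPf ne_lj).
Qed.

Lemma stair_coef_top j : (j < t)%N ->
  stair_coef (j + x).-1 j = 'X^(d j - c (j + x).-1).
Proof.
move=> lt_jt; rewrite /stair_coef /stair lt_jt eqxx mul1r.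
have -> : ((j + x).-1 == j + x)%N = false by move: (x_gt0); lia.
by rewrite add0r.
Qed.

Lemma stair_coef_next j l : (j < t)%N -> l != j ->
  stair_coef (j + x).-1 l = (j == l.+1)%N%:R.
Proof.
move=> lt_jt ne_lj; have x0 : (0 < x)%N by apply/x_gt0/leq_trans/lt_jt.
rewrite /stair_coef.
have -> : ((j + x).-1 == (l + x).-1)%N = false by move/eqP: ne_lj; lia.
have -> : ((j + x).-1 == l + x)%N = (j == l.+1) by lia.
by rewrite mul0r addr0.
Qed.

(** The coordinates q on the staircase are obtained from the coordinates p on b
    by substitution.  Row j + x reads p_(j+x) = q_j + stair_(j+1) q_(j+1): by
    descending induction all q_j are polynomials.  For j >= t the second term
    is 0, and the bound on p_(j+x) is the one on q_j.  Row j + x - 1, for j < t,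
    reads p_(j+x-1) = stair_j q_j + q_(j-1): by ascending induction
    deg q_j + d_j is bounded, because c_(j+x-1) <= c_(j+x-2) <= d_(j-1). *)
Lemma predictable_staircase :
  predictable_degrees (fun i : 'I_(m + x) => b i) (fun i => c i) ->
  predictable_degrees (fun j : 'I_m => staircase j) (fun j => d j).
Proof.
move=> pred_b v q E vE; rewrite ratcomb_staircase => vq.
have := pred_b _ _ _ vE vq; move=> /fin_all_exists[p /all_and2[qp szp]].
have lt_jx (j : 'I_m) : (j + x < m + x)%N by rewrite ltn_add2r.
have q_poly (j : 'I_m) : exists r : {poly F}, q j = tofrac r.
  have [n] := ubnP (m - j)%N; elim: n j => // n IHn j lt_n.
  have := qp (Ordinal (lt_jx j)).
  rewrite (bigD1 j) //= stair_coef_diag tofrac1 mul1r => /(canRL (addrK _)) ->.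
  suff [r ->] : exists r : {poly F}, \sum_(l < m | l != j)
      tofrac (stair_coef (j + x)%N l) * q l = tofrac r.
    by exists (p (Ordinal (lt_jx j)) - r); rewrite tofracB.
  have term (l : 'I_m) : exists r : {poly F},
      l != j -> tofrac (stair_coef (j + x)%N l) * q l = tofrac r.
    case: (ltngtP l j) => [lt_lj|lt_jl|/val_inj->]; last by exists 0; rewrite eqxx.
      by exists 0; rewrite stair_coef_lt // tofrac0 mul0r.
    have [|r qr] := IHn l; first by have := ltn_ord l; lia.
    by exists (stair_coef (j + x)%N l * r); rewrite qr tofracM.
  have [r rP] := fin_all_exists term.
  by exists (\sum_(l < m | l != j) r l); rewrite rmorph_sum; apply: eq_bigr.
have [r qr] := fin_all_exists q_poly.
have pr (i : 'I_(m + x)) : p i = \sum_(j < m) stair_coef i j * r j.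
  apply/eqP; rewrite -tofrac_eq -qp rmorph_sum; apply/eqP/eq_bigr => j _.
  by rewrite qr [RHS]tofracM.
suff le_E n (j : 'I_m) : j = n :> nat -> (size (r j * 'X^(d j))%R <= E)%N.
  by move=> j; exists (r j); split=> //; apply: le_E.
elim/ltn_ind: n j => n IHn j jn.
have [le_tj|lt_jt] := leqP t j.
  have := szp (Ordinal (lt_jx j)); rewrite pr (bigD1 j) //= stair_coef_diag mul1r.
  rewrite big1 ?addr0 => [|l ne_lj]; last by rewrite stair_coef_flat ?mul0r.
  by rewrite eq_cd // le_tj ltn_ord.
have lt_jx1 : ((j + x).-1 < m + x)%N by have := lt_jx j; lia.
have := szp (Ordinal lt_jx1); rewrite pr (bigD1 j) //= stair_coef_top //.
set s := \sum_(l < m | l != j) _ => le_sum.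
have -> : r j * 'X^(d j) = 'X^(d j - c (j + x).-1) * r j * 'X^(c (j + x).-1).
  by rewrite mulrC mulrAC -exprD subnK ?le_cd.
rewrite -['X^(d j - _) * r j](addrK s) mulrBl.
apply: leq_trans (size_polyD _ _) _; rewrite geq_max le_sum size_polyN.
rewrite mulr_suml; apply: leq_trans (size_sum _ _ _) _.
apply/bigmax_leqP => l ne_lj; rewrite stair_coef_next //.
have [jl|] := eqVneq; last by rewrite !mul0r size_poly0.
rewrite mul1r; apply: (@leq_size_mulXn _ _ (d l)); last by apply: (IHn l); lia.
apply: leq_trans (le_cd _); last by lia.
by apply: c_anti; have := lt_jx j; lia.
Qed.

Lemma vdeg_staircase j :
  (forall i, (i < m + x)%N -> vdeg (b i) = c i) -> (j < m)%N ->
  (vdeg (staircase j) <= d j)%N.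
Proof.
move=> deg_b lt_jm; apply/size_boundP => i; rewrite !mxE.
have sz l : (l < m + x)%N -> (size (b l i 0%R) <= (c l).+1)%N.
  by move=> /deg_b <-; apply: size_bound_vdeg.
apply: leq_trans (size_polyD _ _) _; rewrite geq_max /stair.
case: ltnP => [lt_jt|le_tj]; last first.
  by rewrite mul0r size_poly0 eq_cd ?le_tj ?sz //=; lia.
have le1 := le_cd lt_jt; apply/andP; split.
  apply: leq_trans (size_polyMleq _ _) _; rewrite size_polyXn.
  by rewrite addSn /=; apply: leq_trans (leq_add (leqnn _) (sz _ _)) _; lia.
apply: leq_trans (sz _ _) _; first by lia.
by rewrite ltnS; apply: leq_trans le1; apply: c_anti; lia.
Qed.

Lemma staircase_span :
  (<<ratfam (fun j : 'I_m => staircase j)>>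
     <= <<ratfam (fun i : 'I_(m + x) => b i)>>)%VS.
Proof.
apply/subvP => _ /span_ratcomb[q ->]; rewrite ratcomb_staircase.
exact: ratcomb_span.
Qed.

End Staircase.
End PolynomialFamilies.

(** * Kernels of extended matrices *)

Section Kernels.

Variables (F : fieldType) (m n : nat).
Implicit Types (R : 'M[ratfun F]_(m, n)).

Lemma dim_rker m' (R : 'M[ratfun F]_(m', n)) : \dim (rker R) = (n - \rank R)%N.
Proof.
rewrite -[\rank R]mxrank_tr -mxrank_ker.
set B := row_base (kermx R^T).
pose X := [tuple (row i B)^T | i < \rank (kermx R^T)].
apply: (@size_basis _ _ _ _ X); apply/andP; split; last first.
  apply/freeP => k k0 i; pose K := \row_j k j.
  have KB : K *m B = 0.
    apply: trmx_inj; rewrite trmx0 -k0 mulmx_sum_row linear_sum.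
    by apply: eq_bigr => j _; rewrite nth_mktuple linearZ mxE.
  have /matrixP/(_ 0 i) : K = 0.
    by apply: (row_free_inj (row_base_free (kermx R^T))); rewrite KB mul0mx.
  by rewrite !mxE.
rewrite eqEsubv; apply/andP; split.
  apply/span_subvP => _ /mapP[i _ ->]; rewrite rkerP.
  rewrite -trmx_eq0 trmx_mul trmxK -row_mul.
  have /sub_kermxP -> : (B <= kermx R^T)%MS by rewrite eq_row_base.
  by rewrite row0.
apply/subvP => y; rewrite rkerP => /eqP Ry.
have /submxP[K yK] : (y^T <= B)%MS.
  by rewrite eq_row_base; apply/sub_kermxP; rewrite -trmx_mul Ry trmx0.
rewrite -[y]trmxK yK mulmx_sum_row linear_sum memv_suml // => i _.
by rewrite linearZ memvZ // memv_span //; apply/mapP; exists i; rewrite ?mem_enum.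
Qed.

Lemma rker_col_mx z R (W : 'M[ratfun F]_(z, n)) (y : 'cV[ratfun F]_n) :
  (y \in rker (col_mx R W)) = (y \in rker R) && (W *m y == 0).
Proof.
by apply: etrans (rkerP _ _) _; rewrite (rkerP R y) mul_col_mx col_mx_eq0.
Qed.

Lemma rker_col_mx_sub z R (W : 'M[ratfun F]_(z, n)) :
  (rker (col_mx R W) <= rker R)%VS.
Proof.
by apply/subvP => y y_RW; have := etrans (esym (rker_col_mx R W y)) y_RW; case/andP.
Qed.

(** The rows of W are the coordinates of the projection of ker R along U onto a
    complement C of U, completed by zero rows. *)
Lemma subspace_rker z R (U : {vspace 'cV[ratfun F]_n}) :
  (U <= rker R)%VS -> (\dim (rker R) <= \dim U + z)%N ->
  exists W : 'M_(z, n), rker (col_mx R W) = U.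
Proof.
move=> sUV le_z; pose C := (rker R :\: U)%VS; pose f := daddv_pi C U.
have capCU : (C :&: U = 0)%VS by rewrite capv_diff.
have capUC : (U :&: C = 0)%VS by rewrite capvC.
have addCU : (C + U = rker R)%VS.
  by rewrite -[RHS](addv_diff_cap _ U) (capv_idPr sUV).
have dimC : (\dim C <= z)%N.
  by have := dimv_disjoint_sum capCU; rewrite addCU; lia.
pose g (i : 'I_z) y := oapp (fun i' : 'I_(\dim C) => coord (vbasis C) i' (f y)) 0
                            (insub (val i)).
pose W := \matrix_(i < z, j < n) g i (delta_mx j 0).
have Wg y i : (W *m y) i 0 = g i y.
  rewrite mxE /g; under eq_bigr do rewrite mxE /g.
  case: insub => [i'|] /=; last by rewrite big1 // => j _; rewrite mul0r.
  rewrite [in RHS](matrix_sum_delta y) !linear_sum /=; apply: eq_bigr => j _.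
  by rewrite big_ord1 !linearZ /= mulrC.
exists W; apply/vspaceP => y; rewrite rker_col_mx.
apply/andP/idP => [[Ry /eqP Wy]|Uy].
  have fy0 : f y = 0.
    rewrite (coord_vbasis (memv_pi C U y)) big1 // => i _.
    have lt_iz : (i < z)%N by apply: leq_trans dimC.
    have := Wg y (Ordinal lt_iz); rewrite Wy mxE /g /= valK /= => <-.
    by rewrite scale0r.
  have := daddv_pi_add (w := y) capCU; rewrite addCU => /(_ Ry).
  by rewrite -/f fy0 add0r => <-; apply: memv_pi.
split; first exact: subvP sUV y Uy.
have f0 : f y = 0.
  have := daddv_pi_add (w := y) capCU; rewrite addCU => /(_ (subvP sUV y Uy)).
  by rewrite (daddv_pi_id capUC Uy) => /(canRL (addrK _)); rewrite subrr.
apply/eqP/matrixP => i j; rewrite ord1 Wg mxE /g f0.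
by case: insub => //= i'; rewrite linear0.
Qed.

Lemma polynomial_rker z (R : 'M[{poly F}]_(m, n)) (W : 'M[ratfun F]_(z, n)) :
  exists W' : 'M[{poly F}]_(z, n),
    rker (ratmx (col_mx R W')) = rker (col_mx (ratmx R) W).
Proof.
have [g [p [g0 pW]]] := common_denominator (fun ij : 'I_z * 'I_n => W ij.1 ij.2).
exists (\matrix_(i, j) p (i, j)); apply/vspaceP => y.
rewrite map_col_mx [RHS]rker_col_mx; apply: etrans (rker_col_mx _ _ _) _.
congr (_ && _).
have -> : ratmx (\matrix_(i, j) p (i, j)) = tofrac g *: W.
  by apply/matrixP => i j; rewrite !mxE -(pW (i, j)) mulrC.
by rewrite -scalemxAl scaler_eq0 tofrac_eq0 (negPf g0).
Qed.

End Kernels.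

(** * The index h and the terms of c and d *)

Lemma extS (a : seq nat) (j : nat) :
  ext a j.+1%:Z = nth -oo%E [seq (n%:Z)%:E | n <- a] j.
Proof. by []. Qed.

Lemma ext_nth (a : seq nat) (j : nat) :
  (j < size a)%N -> ext a j.+1%:Z = ((nth 0%N a j)%:Z)%:E.
Proof. by move=> lt_j; rewrite extS (nth_map 0%N). Qed.

Lemma ext_oo (a : seq nat) (i : int) : i < 1 -> ext a i = +oo%E.
Proof. by rewrite /ext => ->. Qed.

Lemma ext_default (a : seq nat) (j : nat) :
  (size a <= j)%N -> ext a j.+1%:Z = -oo%E.
Proof. by move=> le_j; rewrite extS nth_default ?size_map. Qed.

(** The infinite conventional terms force h >= x and t <= size d, and, when
    t > 0, that x > 0. *)
Lemma is_h_spec (c d : seq nat) (x : nat) (h : int) :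
  (size d + x = size c)%N -> is_h c d x h ->
  exists t : nat, [/\ h = (t + x)%N%:Z, (t <= size d)%N,
    (0 < t)%N -> (0 < x)%N,
    forall j, (j < t)%N -> (nth 0 c (j + x).-1 <= nth 0 d j)%N &
    (t < size d)%N -> (0 < t + x)%N -> (nth 0 d t < nth 0 c (t + x).-1)%N].
Proof.
move=> sz [lt_h min_h].
have le_xh : x%:Z <= h.
  rewrite leNgt; apply/negP => lt_hx; move: lt_h; rewrite ext_oo; last by lia.
  by rewrite ltNge leey.
have [t ht] : exists t : nat, h = (t + x)%N%:Z by exists `|h - x%:Z|%N; lia.
have idx (j : nat) : (j + x)%N%:Z - x%:Z + 1 = j.+1%:Z by lia.
have le_t : (t <= size d)%N.
  have := min_h (size d + x)%N; rewrite idx ext_default // ht => /(_ _)/wrap[].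
    case: (posnP (size d + x)%N) => [->|gt0]; first by rewrite ext_oo.
    by rewrite -(prednK gt0) ext_nth ?ltNyr //; lia.
  by lia.
have below j : (j < t)%N -> (ext c (j + x)%N <= ext d j.+1%:Z)%E.
  move=> lt_jt; rewrite leNgt -idx; apply/negP => /min_h; lia.
have x_gt0 : (0 < t)%N -> (0 < x)%N.
  move=> t0; rewrite lt0n; apply/eqP => x0; have := below 0%N t0.
  by rewrite x0 ext_oo // ext_nth ?leye_eq //; lia.
exists t; split=> // [j lt_jt | lt_t gt0].
  have gt0 : (0 < j + x)%N by move: x_gt0; lia.
  have := below j lt_jt; rewrite -(prednK gt0) !ext_nth /=; [|lia..].
  by rewrite lee_fin lez_nat.
move: lt_h; rewrite ht idx -{1}(prednK gt0) !ext_nth /=; [|lia..].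
by rewrite lte_fin ltz_nat.
Qed.

(** * Minimal indices of subspaces *)

Section Subspaces.

Variables (F : fieldType) (k : nat).
Implicit Types (V U : {vspace 'cV[ratfun F]_k}).

Lemma perm_minimal_basis V (s1 s2 : seq 'cV[{poly F}]_k) :
  perm_eq s1 s2 -> minimal_basis V s1 -> minimal_basis V s2.
Proof.
move=> eq12 [basis1 min1]; split.
  by rewrite /polynomial_basis -(perm_basis _ (perm_map _ eq12)).
by move=> s /min1; rewrite (perm_big _ eq12).
Qed.

(** The basis is indexed by nat so that the indices can be shifted, and N is
    only propositionally the size of a so that it can be a sum. *)
Lemma minimal_indices_family V a N : size a = N -> minimal_indices V a ->
  exists b : nat -> 'cV[{poly F}]_k,
    minimal_basis V (codom (fun i : 'I_N => b i)) /\
    forall i : nat, (i < N)%N -> vdeg (b i) = nth 0%N a i.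
Proof.
move=> sz [sorted_a [s min_s eq_as]].
pose s' := sort (relpre (@vdeg F k) geq) s.
have geq_anti : antisymmetric geq by move=> p q /anti_leq.
have aE : a = [seq vdeg v | v <- s'].
  rewrite -sort_map; apply: (sorted_eq geq_trans geq_anti sorted_a).
    by apply: sort_sorted => p q; apply: leq_total.
  by rewrite perm_sym perm_sort perm_sym.
have sz' : size s' = N by rewrite -sz aE size_map.
exists (nth 0 s'); rewrite (codom_nth _ sz'); split.
  by apply: perm_minimal_basis min_s; rewrite perm_sym perm_sort.
by move=> i lt_i; rewrite aE (nth_map 0) ?sz'.
Qed.

Lemma minimal_codom_span V N (b : 'I_N -> 'cV[{poly F}]_k) :
  minimal_basis V (codom b) -> V = <<ratfam b>>%VS.
Proof. by case; rewrite polynomial_basis_codom => /span_basis. Qed.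

Lemma minimal_indices_dim V a : minimal_indices V a -> \dim V = size a.
Proof.
case=> _ [s [basis_s _] /perm_size->]; rewrite size_map.
move: basis_s; rewrite /polynomial_basis => /(@size_basis _ _ _ _ (in_tuple _)) ->.
by rewrite size_map.
Qed.

(** For e <= d_t, the vectors of degree at most e span at least as much in U
    as they do in V: below c_(t+x-1) there are at most size c - (t + x) degrees
    in c, and d_t and its successors already provide that many.  Counting turns
    the equality of all these dimensions into the equality of the degrees. *)
Lemma subspace_low_indices V U (c d : seq nat) (x t j : nat) :
  minimal_indices V c -> minimal_indices U d -> (U <= V)%VS ->
  (size d + x = size c)%N -> (t <= j < size d)%N ->
  ((0 < t + x)%N -> (nth 0 d t < nth 0 c (t + x).-1)%N) ->
  nth 0%N d j = nth 0%N c (j + x).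
Proof.
move=> ind_c ind_d sUV sz /andP[le_tj lt_j] lt_dc.
have [sorted_c _] := ind_c; have [sorted_d _] := ind_d.
have [b [min_b deg_b]] := minimal_indices_family erefl ind_c.
have [u [min_u deg_u]] := minimal_indices_family erefl ind_d.
have VE := minimal_codom_span min_b; rewrite VE in min_b sUV.
have UE := minimal_codom_span min_u; rewrite UE in min_u sUV.
have degs (f : nat -> 'cV[{poly F}]_k) (a : seq nat) :
    (forall i, (i < size a)%N -> vdeg (f i) = nth 0%N a i) ->
    codom (fun i : 'I_(size a) => vdeg (f i)) = a.
  move=> deg_f; rewrite -[RHS](codom_nth 0%N (erefl (size a))).
  by apply: eq_codom => i; apply: deg_f.
have lt_t : (t < size d)%N by apply: leq_ltn_trans lt_j.
have count_eq e : (e <= nth 0 d t)%N -> count_atmost e c = count_atmost e d.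
  have := minimal_count_eq min_b min_u sUV.
  rewrite (degs _ _ deg_b) (degs _ _ deg_u); apply.
  have : (size d - t <= count_atmost (nth 0%N d t) d)%N.
    by rewrite -sorted_geq_count.
  apply: leq_trans; case: (posnP (t + x)) => [tx0 | gt0].
    by apply: leq_trans (count_size _ _) _; lia.
  have := lt_dc gt0; rewrite ltnNge sorted_geq_count //; lia.
have le_dt : (nth 0 d j <= nth 0 d t)%N.
  by apply: (sorted_leq_nth geq_trans leqnn 0%N sorted_d).
have same_le e :
    (e <= nth 0 d t)%N -> (nth 0 d j <= e)%N = (nth 0 c (j + x) <= e)%N.
  have lt_jx : (j + x < size c)%N by rewrite -sz ltn_add2r.
  move=> le_e; rewrite (sorted_geq_count e sorted_d lt_j).
  by rewrite (sorted_geq_count e sorted_c lt_jx) count_eq // -sz subnDr.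
have le_c := same_le _ le_dt; rewrite leqnn in le_c.
apply/eqP; rewrite eqn_leq -le_c andbT same_le //.
by apply: leq_trans le_dt; rewrite -le_c.
Qed.

Lemma subspace_with_indices V (c d : seq nat) (x t : nat) :
  minimal_indices V c -> partition_seq d -> (size d + x = size c)%N ->
  (t <= size d)%N -> ((0 < t)%N -> (0 < x)%N) ->
  (forall j, (j < t)%N -> (nth 0 c (j + x).-1 <= nth 0 d j)%N) ->
  (forall j, (t <= j < size d)%N -> nth 0%N d j = nth 0%N c (j + x)) ->
  exists2 U, (U <= V)%VS & minimal_indices U d.
Proof.
move=> ind_c sorted_d sz le_t x_gt0 le_cd eq_cd; have [sorted_c _] := ind_c.
have [b [min_b deg_b]] := minimal_indices_family (esym sz) ind_c.
have VE := minimal_codom_span min_b; rewrite VE in min_b *.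
have c_anti i j : (i <= j < size d + x)%N -> (nth 0 c j <= nth 0 c i)%N.
  case/andP=> le_ij lt_j.
  by apply: (sorted_leq_nth geq_trans leqnn 0%N sorted_c); rewrite // inE; lia.
pose u j := staircase x t b (nth 0%N c) (nth 0%N d) j.
have pred_b : predictable_degrees (fun i : 'I_(size d + x) => b i)
                                  (fun i => nth 0%N c i).
  move=> v a E vE va i; have := minimal_predictable min_b vE va i.
  by rewrite deg_b.
have pred_u := predictable_staircase le_t x_gt0 c_anti le_cd eq_cd pred_b.
have [|min_u deg_u] := predictable_minimal pred_u.
  by move=> j; apply: (vdeg_staircase le_t x_gt0 c_anti le_cd eq_cd).
exists <<ratfam (fun j : 'I_(size d) => u j)>>%VS; first exact: staircase_span.
split=> //; exists (codom (fun j : 'I_(size d) => u j)) => //.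
have degs : [seq vdeg v | v <- codom (fun j : 'I_(size d) => u j)] = d.
  rewrite -[RHS](codom_nth 0%N (erefl (size d))) !codomE -map_comp.
  by apply: eq_map => j; apply: deg_u.
by rewrite degs.
Qed.

End Subspaces.

(** * Completion of matrices *)

Lemma column_indices_condition (c d : seq nat) (x t n r : nat) (h : int) :
  (r + size c = n)%N -> (size d + x = size c)%N -> h = (t + x)%N%:Z ->
  (forall i : int, h - x%:Z + 1 <= i <= n%:Z - r%:Z - x%:Z ->
     ext d i = ext c (i + x%:Z)) <->
  (forall j, (t <= j < size d)%N -> nth 0%N d j = nth 0%N c (j + x)).
Proof.
move=> szc szd ->; split=> [H j /andP[le_tj lt_j] | H i /andP[le_i le_in]].
  have := H j.+1%:Z; rewrite (_ : j.+1%:Z + x%:Z = (j + x).+1%:Z); last by lia.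
  rewrite !ext_nth; [|lia..]; move=> /(_ _)/wrap[]; first by lia.
  by case.
have [j iE] : exists j : nat, i = j.+1%:Z by exists `|i - 1|%N; lia.
rewrite iE (_ : j.+1%:Z + x%:Z = (j + x).+1%:Z); last by lia.
by rewrite !ext_nth ?H //; lia.
Qed.

Theorem theorem3p16 (F : fieldType) (m n r z x : nat) (c d : seq nat) (h : int) :
  (x <= minn z (n - r))%N ->
  partition_seq d -> size d = (n - r - x)%N ->
  is_h c d x h ->
  (forall R : 'M[ratfun F]_(m, n),
     \rank R = r -> column_minimal_indices R c ->
     (exists W : 'M[ratfun F]_(z, n),
        \rank (col_mx R W) = (r + x)%N /\
        column_minimal_indices (col_mx R W) d) <->
     (forall i : int, h - x%:Z + 1 <= i <= n%:Z - r%:Z - x%:Z ->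
        ext d i = ext c (i + x%:Z))) /\
  (forall R : 'M[{poly F}]_(m, n),
     \rank (ratmx R) = r -> column_minimal_indices (ratmx R) c ->
     (exists W : 'M[{poly F}]_(z, n),
        \rank (ratmx (col_mx R W)) = (r + x)%N /\
        column_minimal_indices (ratmx (col_mx R W)) d) <->
     (forall i : int, h - x%:Z + 1 <= i <= n%:Z - r%:Z - x%:Z ->
        ext d i = ext c (i + x%:Z))).
Proof.
move=> le_x sorted_d sz_d is_hh.
have rank_of_dim m' (A : 'M[ratfun F]_(m', n)) :
    (r <= n)%N -> \dim (rker A) = size d -> \rank A = (r + x)%N.
  by rewrite dim_rker; have := rank_leq_col A; lia.
have rational (R : 'M[ratfun F]_(m, n)) :
  \rank R = r -> column_minimal_indices R c ->
  (r <= n)%N /\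
  ((exists W : 'M[ratfun F]_(z, n), column_minimal_indices (col_mx R W) d) <->
   (forall i : int, h - x%:Z + 1 <= i <= n%:Z - r%:Z - x%:Z ->
        ext d i = ext c (i + x%:Z))).
  move=> rk_R ind_c; have le_r : (r <= n)%N by rewrite -rk_R rank_leq_col.
  have dim_R : \dim (rker R) = size c := minimal_indices_dim ind_c.
  have sz_c : (size d + x = size c)%N by rewrite -dim_R dim_rker; lia.
  have [t [ht le_t x_gt0 le_cd lt_dc]] := is_h_spec sz_c is_hh.
  have sz_n : (r + size c = n)%N by rewrite -dim_R dim_rker; lia.
  split=> //; apply: iff_trans (iff_sym (column_indices_condition sz_n sz_c ht)).
  split=> [[W ind_d] j lt_j | eq_cd].
    apply: (subspace_low_indices ind_c ind_d (rker_col_mx_sub R W) sz_c lt_j).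
    by apply: lt_dc; case/andP: lt_j; apply: leq_ltn_trans.
  have [U sUR ind_d] :=
    subspace_with_indices ind_c sorted_d sz_c le_t x_gt0 le_cd eq_cd.
  have [|W WU] := subspace_rker (z := z) sUR.
    by rewrite dim_R (minimal_indices_dim ind_d); lia.
  by exists W; rewrite /column_minimal_indices WU.
split=> R rk_R ind_c; have [le_r ratR] := rational _ rk_R ind_c;
  apply: iff_trans ratR.
  split=> [[W [_ ind_d]] | [W ind_d]]; exists W => //; split=> //.
  exact/rank_of_dim/minimal_indices_dim.
split=> [[W [_ ind_d]] | [W ind_d]].
  by exists (ratmx W); rewrite -map_col_mx.
have [W' W'E] := polynomial_rker R W.
have ind_d' : column_minimal_indices (ratmx (col_mx R W')) d.
  by rewrite /column_minimal_indices W'E.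
exists W'; split; last exact: ind_d'.
exact: rank_of_dim le_r (minimal_indices_dim ind_d').
Qed.
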